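(* Let $\varrho\in(0,1)$, and suppose that the penalty function $\mathrm{pen}:\Theta\to\mathbb R$ and the constant $\mathfrak Q(\varrho)$ are such that $$\mathbf E\exp\Bigl\{\varrho\bigl[\mathcal L(\tilde\theta,\theta_0)+\mathfrak M(\tilde\theta,\theta_0)-\mathrm{pen}(\tilde\theta)\bigr]\Bigr\}\le\mathfrak Q(\varrho).$$ Then for any $\mathfrak r>0$ $$\mathbf P\bigl(\tilde\theta\notin\mathcal A(\mathfrak r,\theta_0)\bigr)=\mathbf P\bigl(\mathfrak M(\tilde\theta,\theta_0)>\mathfrak r\bigr)\le\mathfrak Q(\varrho)\,e^{-\varrho[\mathfrak r-\mathfrak b(\mathfrak r)]},$$ where $\mathcal A(\mathfrak r,\theta_0)=\{\theta\in\Theta:\mathfrak M(\theta,\theta_0)\le\mathfrak r\}$ and $$\mathfrak b(\mathfrak r)=\sup_{\theta\notin\mathcal A(\mathfrak r,\theta_0)}\{\mathfrak r+\mathrm{pen}(\theta)-\mathfrak M(\theta,\theta_0)\}.$$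
   Context: $\Theta\subseteq\mathbb R^p$, and $(\mathcal L(\theta))_{\theta\in\Theta}$ is a real-valued random process on a probability space with measure $\mathbf P$ and expectation $\mathbf E$ (e.g. a scaled quasi log-likelihood). $\theta_0=\arg\max_{\theta\in\Theta}\mathbf E\mathcal L(\theta)$, $\tilde\theta=\arg\max_{\theta\in\Theta}\mathcal L(\theta)$, $\mathcal L(\theta,\theta')=\mathcal L(\theta)-\mathcal L(\theta')$. The rate function $\mathfrak M(\theta,\theta_0)=-\log\mathbf E\exp\{\mathcal L(\theta,\theta_0)\}$ is assumed finite for all $\theta\in\Theta$. In the supremum, $\theta$ ranges over $\Theta\setminus\mathcal A(\mathfrak r,\theta_0)$. *)

(* Defs.v *)
From HB Require Import structures.
From mathcomp Require Import all_boot all_order all_algebra.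
From mathcomp Require Import all_classical all_reals all_analysis.

Set Implicit Arguments.
Unset Strict Implicit.
Unset Printing Implicit Defensive.

Import Order.TTheory GRing.Theory Num.Theory.
Import numFieldNormedType.Exports.

Local Open Scope classical_set_scope.
Local Open Scope ring_scope.

(* Uniqueness of the maximizer is not required. *)
Definition is_argmax (I : Type) (disp : Order.disp_t) (V : porderType disp)
    (f : I -> V) (x : I) : Prop :=
  forall y : I, (f y <= f x)%O.

Section penalized_process.
Context (R : realType) (p : nat) (Theta : set 'rV[R]_p).
Context (d : measure_display) (T : measurableType d) (P : probability T R).
Context (L : Theta -> {RV P >-> R}).

(* L(theta, theta') *)
Definition increment (t t' : Theta) (w : T) : R := L t w - L t' w.

(* - log E exp L(theta, theta0); it is -oo when the exponential moment is
   infinite. *)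
Definition erate (t t0 : Theta) : \bar R :=
  (- lne 'E_P[fun w => expR (increment t t0 w)])%E.

(* The rate function as a real number, meaningful when erate is finite. *)
Definition rate (t t0 : Theta) : R := fine (erate t t0).

Definition local_set (r : R) (t0 : Theta) : set Theta :=
  [set t | rate t t0 <= r].

(* The supremum is taken in the extended reals: it may be +oo, and it is -oo
   when local_set r t0 is all of Theta. *)
Definition bias (pen : Theta -> R) (t0 : Theta) (r : R) : \bar R :=
  ereal_sup [set (r + pen t - rate t t0)%:E | t in ~` local_set r t0].

End penalized_process.

(* Main.v *)
(* Outside the local set the bias gives rate - pen >= r - b(r), and the
   increment is nonnegative at the maximizer, so on the event the exponential
   in the hypothesis is at least exp (rho (r - b(r))): this is Markov's
   inequality. *)
Require Import Defs.
From HB Require Import structures.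
From mathcomp Require Import all_boot all_order all_algebra.
From mathcomp Require Import all_classical all_reals all_analysis.
From mathcomp Require Import measurable_realfun lra.
Import Order.TTheory GRing.Theory Num.Theory.
Import numFieldNormedType.Exports.
Local Open Scope classical_set_scope.
Local Open Scope ring_scope.

(** A nonnegative function with zero integral vanishes almost everywhere. Here it vanishes nowhere,
    so the exceptional null set would be all of [T], which has mass 1. *)
Lemma expectation_gt0 (d : measure_display) (T : measurableType d)
    (R : realType) (P : probability T R) (Y : T -> R) :
  measurable_fun [set: T] Y -> (forall w, 0 < Y w) -> (0 < 'E_P[Y])%E.
Proof.
move=> mY Y0; rewrite unlock lt0e integral_ge0 ?andbT; last first.
  by move=> w _; rewrite lee_fin ltW.
apply/eqP => E0.
have mYe : measurable_fun [set: T] (fun w => (Y w)%:E).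
  exact/measurable_EFinP.
have /(ae_eq_integral_abs P measurableT mYe) : (\int[P]_w `|(Y w)%:E| = 0)%E.
  by rewrite -[RHS]E0; apply: eq_integral => w _; rewrite /= gtr0_norm.
move=> [N [mN PN0 sN]].
have NT : N = setT.
  apply/seteqP; split => // w _; apply: sN => /= /(_ I) [Yw0].
  by have := Y0 w; rewrite Yw0 ltxx.
by have := @probability_setT _ _ _ P; rewrite -NT PN0 => /eqP; rewrite eq_sym onee_eq0.
Qed.

(** Markov's inequality for an event merely contained in a superlevel set of [Y]: compare [c] with
    [Y] on [A], then enlarge the domain of integration from [A] to [T]. *)
Lemma markov_on_event (d : measure_display) (T : measurableType d)
    (R : realType) (P : probability T R) (Y : T -> R) (A : set T) (c : R) :
  measurable_fun [set: T] Y -> (forall w, 0 <= Y w) -> measurable A ->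
  0 <= c -> (forall w, A w -> c <= Y w) -> (c%:E * P A <= 'E_P[Y])%E.
Proof.
move=> mY Y0 mA c0 cY; rewrite unlock.
have mYe : measurable_fun [set: T] (fun w => (Y w)%:E).
  exact/measurable_EFinP.
rewrite -integral_cst//.
apply: (@le_trans _ _ (\int[P]_(w in A) (Y w)%:E)%E).
  apply: ge0_le_integral => //.
  exact: measurable_funS mYe.
by apply: ge0_subset_integral => // w _; rewrite lee_fin.
Qed.

Theorem corollary2p4 (R : realType) (p : nat) (Theta : set 'rV[R]_p)
    (d : measure_display) (T : measurableType d) (P : probability T R)
    (L : Theta -> {RV P >-> R})
    (theta0 : Theta) (thetat : T -> Theta)
    (htheta0 : is_argmax (fun t : Theta => 'E_P[L t]%E) theta0)
    (hthetat : forall w : T, is_argmax (fun t : Theta => L t w) (thetat w))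
    (hrate : forall t : Theta, erate L t theta0 \is a fin_num)
    (rho : R) (hrho : 0 < rho < 1)
    (pen : Theta -> R) (Q : R)
    (hmeas : measurable_fun [set: T] (fun w : T =>
       increment L (thetat w) theta0 w + rate L (thetat w) theta0
       - pen (thetat w)))
    (hQ : ('E_P[fun w : T =>
       expR (rho * (increment L (thetat w) theta0 w
                    + rate L (thetat w) theta0 - pen (thetat w)))]
       <= Q%:E)%E)
    (r : R) (hr : 0 < r)
    (hevent : measurable [set w : T | ~ local_set L r theta0 (thetat w)]) :
  P [set w : T | ~ local_set L r theta0 (thetat w)]
    = P [set w : T | (r < rate L (thetat w) theta0)%R]
  /\
  (P [set w : T | (r < rate L (thetat w) theta0)%R]
    <= Q%:E * expeR (- (rho%:E * (r%:E - bias L pen theta0 r))))%E.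
Proof.
have AE : [set w : T | ~ local_set L r theta0 (thetat w)] =
          [set w : T | (r < rate L (thetat w) theta0)%R].
  by apply/seteqP; split => w; rewrite /local_set /= ltNge => /negP.
split; first by rewrite AE.
rewrite -AE; set A := [set w | _] in hevent *.
have /andP[rho0 _] := hrho.
set Y := fun w : T => expR _ in hQ.
have mY : measurable_fun [set: T] Y.
  by apply: measurableT_comp => //; apply: measurable_funM.
have Y0 w : 0 < Y w by exact: expR_gt0.
(* [Q] bounds the mean of the strictly positive [Y]; its sign settles both cases of infinite
   bias. *)
have Q0 : 0 < Q by rewrite -lte_fin (lt_le_trans _ hQ)// expectation_gt0.
have le_bias w : A w ->
    ((r + pen (thetat w) - rate L (thetat w) theta0)%:E <= bias L pen theta0 r)%E.
  by move=> Aw; apply: ereal_sup_ubound; exists (thetat w).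
(* [le_bias] follows the split: a real bound for finite [b], vacuous at [+oo], contradictory at
   [-oo]. *)
case: (bias L pen theta0 r) le_bias => [b| |] le_bias.
(* Moving the exponential to the left leaves Markov's inequality with level
   [expR (rho * (r - b))]. *)
- rewrite -[expeR _]/((expR (- (rho * (r - b))))%:E) expRN muleC.
  rewrite lee_pdivlMl ?expR_gt0//; apply: le_trans hQ.
  apply: markov_on_event => //; first by move=> w; exact: ltW.
  move=> w Aw; rewrite ler_expR ler_pM2l//.
  have := le_bias _ Aw; rewrite lee_fin.
  have : 0 <= increment L (thetat w) theta0 w by rewrite subr_ge0; exact: hthetat.
  by lra.
(* Infinite bias: Q > 0 is essential here, since 0 * +oo = 0. *)
- by rewrite -[(_ - +oo)%E]/(-oo)%E gt0_muleNy ?lte_fin// gt0_muley ?lte_fin// leey.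
(* A point of [A] would place a real number below [-oo], so the event is empty. *)
- have -> : A = set0 by rewrite -subset0 => w /le_bias.
  by rewrite measure0 mule_ge0 ?expeR_ge0// lee_fin ltW.
Qed.
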